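(* Let $S$ be a semigroup with $0$ (not necessarily commutative). Then the directed graph $\Gamma(S)$ is connected if and only if $A^{l}(S)=A^{r}(S)$. Moreover, if $\Gamma(S)$ is connected, then $\mathrm{diam}(\Gamma(S))\le 3$.
   Context: $D(S)$ is the set of one-sided zero-divisors of $S$, and $D(S)^{*}=D(S)\setminus\{0\}$; thus a nonzero $a\in S$ lies in $D(S)^*$ iff there is a nonzero $b\in S$ with $ab=0$ or $ba=0$. $\Gamma(S)$ is the directed graph with vertex set $D(S)^{*}$ and a directed edge $a\rightarrow b$ if $ab=0$. Define $$A^{l}(S)=\{a\in D(S)^{*} : \text{there exists } b\in D(S)^{*} \text{ with } ba=0\},\qquad A^{r}(S)=\{a\in D(S)^{*} : \text{there exists } b\in D(S)^{*} \text{ with } ab=0\}.$$ A directed graph is connected if for every ordered pair of distinct vertices $(a,b)$ there is a directed path from $a$ to $b$. $d(x,y)$ is the length of a shortest directed path from $x$ to $y$ ($d(x,x)=0$, and $d(x,y)=\infty$ if there is no path), and $\mathrm{diam}$ is the supremum of $d(x,y)$ over all vertices $x,y$. *)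

(* Defs.v *)
From HB Require Import structures.
From mathcomp Require Import all_boot all_order all_algebra.
From mathcomp Require Import boolp classical_sets reals ereal.

Set Implicit Arguments.
Unset Strict Implicit.
Unset Printing Implicit Defensive.

Import Order.TTheory GRing.Theory Num.Theory.

Local Open Scope classical_set_scope.

                                                                              
                                                
Record digraph (T : Type) := Digraph {
  vertices : set T;
  edge : rel T
}.

Section Digraph.
Variables (T : eqType) (G : digraph T).

                                                                            
                                                                             
                                          
Definition dipath (x y : T) : set (seq T) :=
  [set p | [/\ path (edge G) x p, last x p = y, uniq (x :: p)
             & forall v, v \in x :: p -> vertices G v]].

Definition connected_digraph : Prop :=
  forall a b, vertices G a -> vertices G b -> a <> b -> dipath a b !=set0.

                                          
Definition dist (R : realType) (x y : T) : \bar R :=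
  ereal_inf [set ((size p)%:R)%:E | p in dipath x y].

                                                                         
Definition diam (R : realType) : \bar R :=
  ereal_sup [set dist R x y | x in vertices G & y in vertices G].

End Digraph.

Section ZeroDivisorGraph.
Local Open Scope group_scope.
Variables (S : semigroupType) (zero : S).

Definition zero_divisors : set S :=
  [set a | exists2 b, b <> zero & a * b = zero \/ b * a = zero].

Definition nz_zero_divisors : set S := zero_divisors `\ zero.

Definition zero_divisor_digraph : digraph S :=
  Digraph nz_zero_divisors (fun a b => a * b == zero).

Definition Al : set S :=
  [set a | nz_zero_divisors a /\
           exists2 b, nz_zero_divisors b & b * a = zero].

Definition Ar : set S :=
  [set a | nz_zero_divisors a /\
           exists2 b, nz_zero_divisors b & a * b = zero].

End ZeroDivisorGraph.

(* Main.v *)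
Require Import Defs.
From mathcomp Require Import all_boot all_order all_algebra.
From mathcomp Require Import boolp classical_sets reals ereal.

(** Every vertex [a] lies in [Al] or in [Ar], since a nonzero [b] witnessing
    that [a] is a zero-divisor is itself a vertex.  So [Al = Ar] says exactly
    that every vertex is annihilated by vertices on both sides.

    A nontrivial path out of a vertex exhibits a right annihilator of it, and a
    nontrivial path into a vertex a left one.  Hence, when the graph is
    connected and [b * a = 0] with [b <> a], the path back from [a] to [b] gives
    [a] an annihilator on the other side; this is [connected_Al_eq_Ar].

    Conversely, let [a], [b] be vertices with [a * c = 0] and [d * b = 0], where
    [c], [d] are vertices.  If [c * d = 0] there is the walk a, c, d, b.
    Otherwise [c * d] is a nonzero element killed by [a] on the left and by [b]
    on the right, and there is the walk a, cd, b.  Deleting loops leaves a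
    simple path of length at most three ([short_dipath]), which gives both
    connectedness and the bound on the diameter. *)

Local Open Scope classical_set_scope.

Section Digraph.
Context {T : eqType} {G : digraph T}.

(** Directed paths are simple, whereas the walks found from annihilators may
    revisit a vertex; loop deletion never lengthens a walk. *)
Lemma walk_dipath (x : T) (p : seq T) :
  path (edge G) x p -> (forall v, v \in x :: p -> vertices G v) ->
  exists2 q, dipath G x (last x p) q & size q <= size p.
Proof.
move=> xp vp; case/shortenP: xp => q xq uq qp.
exists q; last by apply: uniq_leq_size qp; case/andP: uq.
split=> // v; rewrite inE => /predU1P[->|/qp vq]; apply: vp.
  exact: mem_head.
by rewrite inE vq orbT.
Qed.

Lemma dipath_first_edge {x y : T} :
  dipath G x y !=set0 -> x <> y -> exists2 z, vertices G z & edge G x z.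
Proof.
move=> [[|z p] /= [xp lp _ vp]] nxy; first by case: nxy.
exists z; last by case/andP: xp.
by apply: vp; rewrite !inE eqxx orbT.
Qed.

Lemma dipath_last_edge {x y : T} :
  dipath G x y !=set0 -> x <> y -> exists2 z, vertices G z & edge G z y.
Proof.
move=> [p]; case: (lastP p) => [[_ <- //]|{}p z [xp + _ vp]] nxy.
rewrite last_rcons => zy; exists (last x p); last first.
  by move: xp; rewrite rcons_path zy => /andP[].
by apply: vp; rewrite -rcons_cons mem_rcons inE mem_last orbT.
Qed.

Lemma diam_le {R : realType} {n : nat} :
  (forall x y, vertices G x -> vertices G y ->
     exists2 p, dipath G x y p & size p <= n) ->
  (diam G R <= (n%:R)%R%:E)%E.
Proof.
move=> short; apply: ge_ereal_sup => _ [x vx [y vy <-]].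
have [p xyp pn] := short x y vx vy.
apply: (@Order.POrderTheory.le_trans _ _ ((size p)%:R)%R%:E).
  by apply: ereal_inf_lbound; exists p.
by rewrite lee_fin Num.Theory.ler_nat.
Qed.

End Digraph.

Section ZeroDivisorGraph.
Local Open Scope group_scope.
Context {S : semigroupType} {zero : S}.

Local Notation vertex := (nz_zero_divisors zero).
Local Notation Gamma := (zero_divisor_digraph zero).

Lemma mul_eq0_vertices {a b : S} :
  a <> zero -> b <> zero -> a * b = zero -> vertex a /\ vertex b.
Proof.
move=> a0 b0 ab; split; split=> //; first by exists b => //; left.
by exists a => //; right.
Qed.

Lemma vertex_AlVAr {a : S} : vertex a -> Al zero a \/ Ar zero a.
Proof.
move=> va; have [[b b0 [ab|ba]] a0] := va.
- by right; split=> //; exists b => //; have [] := mul_eq0_vertices a0 b0 ab.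
- by left; split=> //; exists b => //; have [] := mul_eq0_vertices b0 a0 ba.
Qed.

(** When [b * a = 0] with [b = a], the loop at [a] already puts [a] on both
    sides; connectedness only speaks of distinct vertices. *)
Lemma connected_Al_eq_Ar : connected_digraph Gamma -> Al zero = Ar zero.
Proof.
move=> conn; rewrite eqEsubset; split=> a [va [b vb]] ab0; split=> //.
- have [ba|/eqP nba] := eqVneq b a; first by subst; exists a.
  have [c vc /eqP ac] := dipath_first_edge (conn _ _ va vb (nesym nba)) (nesym nba).
  by exists c.
- have [ba|/eqP nba] := eqVneq b a; first by subst; exists a.
  have [c vc /eqP ca] := dipath_last_edge (conn _ _ vb va nba) nba.
  by exists c.
Qed.

Hypothesis (mul0s : left_zero zero ( *%g : S -> S -> S)).
Hypothesis (muls0 : right_zero zero ( *%g : S -> S -> S)).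

(** Three steps suffice because a right annihilator [c] of [a] and a left
    annihilator [d] of [b] are either adjacent, or have a nonzero product that
    is adjacent to [a] and to [b] at once.  The case [a = b] is allowed: the
    resulting closed walk then shrinks to the empty path. *)
Lemma short_dipath {a b : S} : Al zero = Ar zero -> vertex a -> vertex b ->
  exists2 p, dipath Gamma a b p & size p <= 3.
Proof.
move=> AlAr va vb.
have [_ [c vc ac]] : Ar zero a by case: (vertex_AlVAr va); rewrite ?AlAr.
have [_ [d vd db]] : Al zero b by case: (vertex_AlVAr vb); rewrite ?AlAr.
have [cd|/eqP cd] := eqVneq (c * d) zero.
  apply: (@walk_dipath _ Gamma a [:: c; d; b]); first by rewrite /= ac cd db eqxx.
  by move=> v; rewrite !inE => /or4P[] /eqP->.
have acd : a * (c * d) = zero by rewrite mulgA ac mul0s.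
have cdb : (c * d) * b = zero by rewrite -mulgA db muls0.
have [_ a0] := va; have [_ vcd] := mul_eq0_vertices a0 cd acd.
have [|v|p abp p2] := @walk_dipath _ Gamma a [:: c * d; b].
- by rewrite /= acd cdb eqxx.
- by rewrite !inE => /or3P[] /eqP->.
- by exists p => //; apply: leq_trans p2 _.
Qed.

End ZeroDivisorGraph.

Theorem theorem2p3 (R : realType) (S : semigroupType) (zero : S)
    (mul0s : left_zero zero ( *%g : S -> S -> S)) (muls0 : right_zero zero ( *%g : S -> S -> S)) :
  (connected_digraph (zero_divisor_digraph zero) <-> Al zero = Ar zero) /\
  (connected_digraph (zero_divisor_digraph zero) ->
     (diam (zero_divisor_digraph zero) R <= 3%:R%:E)%E).
Proof.
split; first split; first exact: connected_Al_eq_Ar.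
- move=> AlAr a b va vb _.
  by have [p abp _] := short_dipath mul0s muls0 AlAr va vb; exists p.
- move=> /connected_Al_eq_Ar AlAr; apply: diam_le => a b.
  exact: short_dipath.
Qed.
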